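(* For every integer $k\geq1$ there exists a finite simple graph $G$ of class $2^\pm$ with $\Delta(G)=2k+1$.
   Context: A signed graph is a pair $(G,\sigma)$ with $G$ a finite simple graph and $\sigma\colon E(G)\to\{\pm1\}$ a signature. An incidence is a pair $v\colon e$ with $v$ an endpoint of edge $e$; $I(G)$ is the set of incidences. For a positive integer $n$ let $M_n=\{0,\pm1,\dots,\pm k\}$ if $n=2k+1$ and $M_n=\{\pm1,\dots,\pm k\}$ if $n=2k$. An $n$-edge-coloring of $(G,\sigma)$ is a map $f\colon I(G)\to M_n$ with $f(u\colon uv)=-\sigma(uv)f(v\colon uv)$ for every edge $uv$, and $f(u\colon e_1)\neq f(u\colon e_2)$ whenever $e_1\neq e_2$ are both incident to $u$. The chromatic index $\chi'(G,\sigma)$ is the least positive integer $n$ for which an $n$-edge-coloring exists. A graph $G$ is of class $2^\pm$ if $\chi'(G,\sigma)=\Delta(G)+1$ for every signature $\sigma$ of $G$, where $\Delta(G)$ is the maximum degree. *)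

(* Defs.v *)
From HB Require Import structures.
From mathcomp Require Export all_boot all_order all_algebra.

Set Implicit Arguments.
Unset Strict Implicit.
Unset Printing Implicit Defensive.

Import GRing.Theory.
Local Open Scope ring_scope.

Record sgraph := SGraph {
  vertex :> finType;
  adj : rel vertex;
  adj_sym : symmetric adj;
  adj_irrefl : irreflexive adj
}.

Definition edges (G : sgraph) : {set {set G}} :=
  [set [set p.1; p.2] | p : G * G & adj p.1 p.2].

Definition incidence (G : sgraph) (v : G) (e : {set G}) : bool :=
  (e \in edges G) && (v \in e).

Definition degree (G : sgraph) (v : G) : nat := #|[set w | adj v w]|.

Definition max_degree (G : sgraph) : nat := (\max_(v : G) degree v)%N.

(* Only the values of s on the edges matter. *)
Definition signature (G : sgraph) (s : {set G} -> int) : Prop :=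
  forall e, e \in edges G -> s e = 1 \/ s e = -1.

(* The set M_n: {0, ±1, ..., ±k} if n = 2k+1, {±1, ..., ±k} if n = 2k. *)
Definition colors (n : nat) (c : int) : bool :=
  (`|c|%N <= n./2)%N && (odd n || (c != 0)).

(* f v e is the color of the incidence v:e; f is irrelevant elsewhere. *)
Definition edge_coloring (G : sgraph) (s : {set G} -> int) (n : nat)
    (f : G -> {set G} -> int) : Prop :=
  [/\ forall v e, incidence v e -> colors n (f v e),
      forall u v, adj u v ->
        f u [set u; v] = - s [set u; v] * f v [set u; v]
    & forall u e1 e2, incidence u e1 -> incidence u e2 -> e1 != e2 ->
        f u e1 != f u e2].

Definition edge_colorable (G : sgraph) (s : {set G} -> int) (n : nat) : Prop :=
  exists f : G -> {set G} -> int, edge_coloring s n f.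

Definition is_chromatic_index (G : sgraph) (s : {set G} -> int) (n : nat)
    : Prop :=
  [/\ (0 < n)%N, edge_colorable s n
    & forall m, (0 < m)%N -> edge_colorable s m -> (n <= m)%N].

Definition class2pm (G : sgraph) : Prop :=
  forall s : {set G} -> int,
    signature s -> is_chromatic_index s (max_degree G).+1.

(* Main.v *)
(** Let [n = k + 1].  Take the complete graph on [2n] vertices, delete the
    diameters [{j, j + n}] with [0 < j < n], and join a new vertex [w] to their
    [2n - 2] endpoints; join the vertices [w] of two such pieces to a common
    vertex [c].  Every vertex but [c] has degree [2k + 1].

    With at most [2k + 1] colors, a vertex of degree [2k + 1] sees the color
    [0], so the edges colored [0] would match all vertices but [c].  One of the
    two pieces would then be matched within itself, but it has [2n + 1]
    vertices.

    For [2k + 2] colors it suffices to split the edges into [n] linear forests: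
    along a path, the colors [i] and [-i] can be assigned to suit any signature.
    The complete graph on [2n] vertices splits into [n] zigzag Hamiltonian
    paths, whose middle edges are the diameters.  Replacing a middle edge by a
    detour through [w] keeps the path a path, and the path that keeps its middle
    edge avoids [w], leaving room for the edges at [c]. *)

Require Import Defs.
From mathcomp Require Import all_boot all_order all_algebra.
From mathcomp Require Import zify.

Set Implicit Arguments.
Unset Strict Implicit.
Unset Printing Implicit Defensive.

Import GRing.Theory.

(** * Involutions on finite sets of odd size *)

Lemma odd_fixpoint_of_involution (T : finType) (A : {set T}) (g : T -> T) :
  odd #|A| -> {in A, forall x, g x \in A} -> {in A, forall x, g (g x) = x} ->
  exists2 x, x \in A & g x = x.
Proof.
move=> oddA gA gK.
case: (pickP [pred x in A | g x == x]) => [x /andP[xA /eqP gx]|nofix].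
  by exists x.
(* Without fixed points, [A] is the disjoint union of the points whose rank [g] raises and those
   whose rank it lowers. Since [g] swaps the two sets, [#|A|] would be even. *)
pose L := [set x in A | enum_rank x < enum_rank (g x)].
pose U := [set x in A | enum_rank (g x) < enum_rank x].
have cardLU : #|L| = #|U|.
  have injg (B : {set T}) : B \subset A -> {in B &, injective g}.
    by move=> /subsetP sBA x y xB yB e; rewrite -[x]gK ?sBA // e gK ?sBA.
  have imgS (B C : {set T}) : B \subset A -> {in B, forall x, g x \in C} ->
      #|B| <= #|C|.
    move=> sBA BC; rewrite -(card_in_imset (injg _ sBA)) subset_leq_card //.
    by apply/subsetP => _ /imsetP[x xB ->]; apply: BC.
  have sLU : L \subset A /\ U \subset A.
    by split; apply/subsetP=> x; rewrite inE => /andP[].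
  apply/eqP; rewrite eqn_leq !imgS ?sLU.1 ?sLU.2 //;
    by move=> x; rewrite !inE => /andP[xA lx]; rewrite gA //= gK.
have AE : A = L :|: U.
  apply/setP=> x; rewrite !inE -andb_orr; case xA: (x \in A) => //=.
  rewrite -neq_ltn; apply/esym/negP => /eqP/val_inj/enum_rank_inj e.
  by have := nofix x; rewrite /= xA -e eqxx.
have disj : L :&: U = set0.
  by apply/setP=> x; rewrite !inE; apply/negP; lia.
by move: oddA; rewrite AE cardsU disj cards0 subn0 cardLU addnn odd_double.
Qed.

(** * Edges and incidences of a simple graph *)

Section Incidences.

Variable G : sgraph.
Implicit Types u v : G.

Lemma adj_neq u v : adj u v -> u != v.
Proof. by apply: contraTneq => ->; rewrite adj_irrefl. Qed.

Lemma edges_adj u v : adj u v -> [set u; v] \in edges G.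
Proof. by move=> uv; apply/imsetP; exists (u, v); rewrite ?inE. Qed.

Lemma incidence_adj u v : adj u v -> incidence u [set u; v].
Proof. by move=> uv; rewrite /incidence edges_adj // !inE eqxx. Qed.

Lemma incidenceP v (e : {set G}) :
  incidence v e -> exists2 u, adj v u & e = [set v; u].
Proof.
case/andP=> /imsetP[[x y]]; rewrite inE /= => xy ->.
rewrite !inE => /orP[] /eqP->; first by exists y.
by exists x; rewrite 1?adj_sym // setUC.
Qed.

Lemma set2_injr v u1 u2 : adj v u1 -> [set v; u1] = [set v; u2] -> u1 = u2.
Proof.
move=> /adj_neq v1 /setP/(_ u1); rewrite !inE eqxx orbT eq_sym (negPf v1) /=.
by move/esym/eqP.
Qed.

End Incidences.

(** * Coloring a graph that is split into linear forests *)

Section LinearForests.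

Local Open Scope ring_scope.

(** [cls u v] is the forest containing the edge [uv]; [pos i] lays all vertices out on a line so
    that the edges of forest [i] join neighboring positions. *)
Variables (G : sgraph) (K : nat) (cls : G -> G -> nat) (pos : nat -> G -> nat).
Hypothesis cls_sym : forall u v, cls u v = cls v u.
Hypothesis cls_lt : forall u v, adj u v -> (cls u v < K)%N.
Hypothesis pos_inj : forall i, (i < K)%N -> injective (pos i).
Hypothesis pos_adj : forall u v, adj u v ->
  pos (cls u v) v = (pos (cls u v) u).+1 \/
  pos (cls u v) u = (pos (cls u v) v).+1.

Variable s : {set G} -> int.
Hypothesis sign_s : signature s.

(** The value 1 at a gap keeps the products in [path_sign] equal to 1 or -1 across consecutive paths
    of a forest. *)
Definition step_sign (i j : nat) : int :=
  if [pick p : G * G | [&& adj p.1 p.2, pos i p.1 == j & pos i p.2 == j.+1]]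
  is Some p then s [set p.1; p.2] else 1.

Definition path_sign (i m : nat) : int := \prod_(j < m) step_sign i j.

Lemma step_sign_unit i j : step_sign i j = 1 \/ step_sign i j = -1.
Proof.
rewrite /step_sign; case: pickP => [[u v] /= /and3P[uv _ _]|_]; last by left.
exact/sign_s/edges_adj.
Qed.

Lemma path_sign_unit i m : path_sign i m = 1 \/ path_sign i m = -1.
Proof.
rewrite /path_sign; elim: m => [|m IH]; first by left; rewrite big_ord0.
by rewrite big_ord_recr /=; case: IH => ->; case: (step_sign_unit i m) => ->;
  rewrite ?mul1r ?mulN1r ?opprK; auto.
Qed.

Lemma path_sign_adj i u v : (i < K)%N -> adj u v -> pos i v = (pos i u).+1 ->
  path_sign i (pos i v) = path_sign i (pos i u) * s [set u; v].
Proof.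
move=> iK uv e; rewrite e /path_sign big_ord_recr /=; congr (_ * _).
rewrite /step_sign; case: pickP => [[x y] /= /and3P[_ /eqP xu /eqP yv]|].
  by rewrite -e in yv; rewrite (pos_inj iK xu) (pos_inj iK yv).
by move/(_ (u, v)); rewrite /= uv e !eqxx.
Qed.

(** The accumulated sign fixes the color up to direction: forward and backward arcs at [v] get
    opposite colors. Crossing an edge reverses the direction and multiplies by its sign, which gives
    the factor [- s] of a coloring. The shift [i.+1] avoids the color 0. *)
Definition arc_color (v u : G) : int :=
  let i := cls v u in
  (if pos i u == (pos i v).+1 then 1 else -1) * path_sign i (pos i v) * i.+1%:Z.

Definition forest_coloring (v : G) (e : {set G}) : int :=
  if [pick u | adj v u & e == [set v; u]] is Some u then arc_color v u else 0.

Lemma forest_coloringE v u : adj v u ->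
  forest_coloring v [set v; u] = arc_color v u.
Proof.
move=> vu; rewrite /forest_coloring; case: pickP => [x /andP[vx /eqP e]|].
  by rewrite (set2_injr vu e).
by move/(_ u); rewrite vu eqxx.
Qed.

Lemma absz_arc_color v u : `|arc_color v u|%N = (cls v u).+1.
Proof.
rewrite /arc_color /=; case: (path_sign_unit (cls v u) (pos (cls v u) v)) => ->;
by case: ifP => _; rewrite ?mul1r ?mulN1r ?opprK ?mul1r // ?abszN.
Qed.

Lemma arc_color_inj v u1 u2 : adj v u1 -> adj v u2 ->
  arc_color v u1 = arc_color v u2 -> u1 = u2.
Proof.
move=> vu1 vu2 e; have ec : cls v u1 = cls v u2.
  by apply: succn_inj; rewrite -!absz_arc_color e.
have iK := cls_lt vu1; have := pos_adj vu1; have := pos_adj vu2.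
move: e; rewrite /arc_color -ec => e p2 p1.
apply: (pos_inj iK).
(* Opposite directions would give opposite nonzero colors, so both neighbors lie on the same side of
   [v], hence at the same position. *)
have neg (x : int) : x = 1 \/ x = -1 ->
    1 * x * (cls v u1).+1%:Z <> -1 * x * (cls v u1).+1%:Z.
  by case=> ->; lia.
have ne := neg _ (path_sign_unit (cls v u1) (pos (cls v u1) v)).
by move: e; case: eqP => q1; case: eqP => q2 // e; lia.
Qed.

Lemma linear_forests_colorable : edge_colorable s K.*2.
Proof.
exists forest_coloring; split.
- move=> v e /incidenceP[u vu ->]; rewrite forest_coloringE //.
  rewrite /colors absz_arc_color doubleK cls_lt //= odd_double /=.
  by rewrite -absz_eq0 absz_arc_color.
- move=> u v uv; have vu : adj v u by rewrite adj_sym.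
  rewrite forest_coloringE // setUC forest_coloringE // setUC.
  rewrite /arc_color (cls_sym v u); set i := cls u v.
  have iK : (i < K)%N := cls_lt uv.
  have sE := sign_s (edges_adj uv).
  case: (pos_adj uv); rewrite -/i => e.
    rewrite (path_sign_adj iK uv e) e eqxx.
    have -> : (pos i u == (pos i u).+2) = false by lia.
    by case: sE => ->; lia.
  rewrite (path_sign_adj iK vu e) e eqxx (setUC [set v]).
  have -> : (pos i v == (pos i v).+2) = false by lia.
  by case: sE => ->; lia.
- move=> v e1 e2 /incidenceP[u1 vu1 ->] /incidenceP[u2 vu2 ->].
  rewrite !forest_coloringE //; apply: contraNneq => /arc_color_inj.
  by move=> ->.
Qed.

End LinearForests.

(** * Edges colored zero *)

Section ZeroColor.

Local Open Scope ring_scope.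

Variables (G : sgraph) (s : {set G} -> int) (k m : nat).
Variable f : G -> {set G} -> int.
Hypothesis f_col : edge_coloring s m f.
Hypothesis m_le : (m <= k.*2.+1)%N.

(** The colors at [v] are distinct integers in [-k, k]. There are 2k + 1 of them, so each integer of
    the interval occurs; [g] shifts the interval by k, sending 0 to k. *)
Lemma zero_color_adj v : degree v = k.*2.+1 ->
  exists2 u, adj v u & f v [set v; u] = 0.
Proof.
case: f_col => f_colors _ f_inj dv.
pose g u : 'I_k.*2.+1 := inord (absz (f v [set v; u] + k%:Z)).
have bound u : adj v u -> (`|f v [set v; u]| <= k)%N.
  move/incidence_adj/f_colors/andP => [le _]; apply: leq_trans le _.
  by have := half_leq m_le; rewrite /= uphalf_double.
have valg u : adj v u -> g u = absz (f v [set v; u] + k%:Z) :> nat.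
  by move=> /bound b; rewrite inordK //; lia.
have injg : {in [set u | adj v u] &, injective g}.
  move=> x y; rewrite !inE => vx vy /(congr1 val); rewrite /= !valg // => e.
  have := bound x vx; have := bound y vy => by_ bx.
  apply: (set2_injr vx); apply/eqP; apply: contraT => ne.
  have := f_inj v _ _ (incidence_adj vx) (incidence_adj vy) ne; lia.
have imgT : g @: [set u | adj v u] = [set: 'I_k.*2.+1].
  apply/eqP; rewrite eqEcard subsetT cardsT card_ord.
  by rewrite (card_in_imset injg) -dv leqnn.
have : inord k \in g @: [set u | adj v u] by rewrite imgT inE.
case/imsetP=> u; rewrite inE => vu /(congr1 val) /=.
rewrite valg // inordK; last by lia.
by exists u => //; have := bound u vu; lia.
Qed.

Lemma zero_color_sym u v : adj u v -> f u [set u; v] = 0 -> f v [set v; u] = 0.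
Proof.
case: f_col => _ f_sym _ uv e; rewrite f_sym; last by rewrite adj_sym.
by rewrite setUC e mulr0.
Qed.

Lemma zero_color_uniq v u1 u2 : adj v u1 -> adj v u2 ->
  f v [set v; u1] = 0 -> f v [set v; u2] = 0 -> u1 = u2.
Proof.
case: f_col => _ _ f_inj vu1 vu2 e1 e2; apply: (set2_injr vu1).
apply/eqP; apply: contraT => ne.
have := f_inj v _ _ (incidence_adj vu1) (incidence_adj vu2) ne.
by rewrite e1 e2.
Qed.

End ZeroColor.

(** * Zigzag Hamiltonian paths of the complete graph *)

Section Zigzag.

Variable n : nat.

Definition antipode (x : nat) : nat := if x < n then x + n else x - n.

Definition on_kept_diameter (x : nat) : bool := (x == 0) || (x == n).

(* The class of the edge [xy] of the complete graph is the [i] such that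
   [x + y] is [2i] or [2i + 1] modulo [2n]; the [i]-th path visits
   [i, i + 1, i - 1, i + 2, i - 2, ...] modulo [2n], so that the position of
   [i + d] is [2d - 1] (truncated when [d = 0]) or [4n - 2d]. *)
Definition zigzag_class (x y : nat) : nat :=
  (if x + y < n.*2 then x + y else x + y - n.*2)./2.

Definition zigzag_pos (i x : nat) : nat :=
  let d := if i <= x then x - i else x + n.*2 - i in
  if d <= n then d.*2 - 1 else (n.*2 - d).*2.

Lemma antipode_lt x : x < n.*2 -> antipode x < n.*2.
Proof. by rewrite /antipode; case: ifP; lia. Qed.

Lemma antipode_neq x : x < n.*2 -> antipode x != x.
Proof. by rewrite /antipode; case: ifP; lia. Qed.

Lemma zigzag_class_sym x y : zigzag_class x y = zigzag_class y x.
Proof. by rewrite /zigzag_class addnC. Qed.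

Lemma zigzag_class_lt x y : x < n.*2 -> y < n.*2 -> zigzag_class x y < n.
Proof. by rewrite /zigzag_class; case: ifP; lia. Qed.

Lemma zigzag_pos_lt i x : i < n -> x < n.*2 -> zigzag_pos i x < n.*2.
Proof. by rewrite /zigzag_pos; do 2!case: ifP; lia. Qed.

Lemma zigzag_pos_inj i x y : i < n -> x < n.*2 -> y < n.*2 ->
  zigzag_pos i x = zigzag_pos i y -> x = y.
Proof. by rewrite /zigzag_pos; do 4!case: ifP; lia. Qed.

(** Along path [i], the sums of consecutive vertices alternate between 2i + 1 and 2i modulo 2n, and
    either sum determines the partner of a vertex. *)
Lemma zigzag_pos_adj x y : x < n.*2 -> y < n.*2 -> x != y ->
  let i := zigzag_class x y in
  zigzag_pos i y = (zigzag_pos i x).+1 \/ zigzag_pos i x = (zigzag_pos i y).+1.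
Proof. by rewrite /zigzag_pos /zigzag_class; do 5!case: ifP; lia. Qed.

Lemma zigzag_pos_antipode x : x < n.*2 ->
  let i := zigzag_class x (antipode x) in
  zigzag_pos i x = n \/ (zigzag_pos i x).+1 = n.
Proof.
by rewrite /zigzag_pos /zigzag_class /antipode; do 4!case: ifP; lia.
Qed.

(** Only the middle edge crosses between the two halves of a path, so moving the second half up by
    one keeps all other edges consecutive. *)
Lemma zigzag_pos_side x y : x < n.*2 -> y < n.*2 -> x != y ->
  y != antipode x -> let i := zigzag_class x y in
  (n <= zigzag_pos i x) = (n <= zigzag_pos i y).
Proof.
by rewrite /zigzag_pos /zigzag_class /antipode; do 6!case: ifP; lia.
Qed.

(** For x < n the endpoints of the diameter sum to 2x + n, so its class is x + [n./2] modulo n. *)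
Lemma zigzag_class_antipode x : x < n.*2 ->
  (zigzag_class x (antipode x) == n./2) = on_kept_diameter x.
Proof.
by rewrite /zigzag_class /antipode /on_kept_diameter; do 2!case: ifP; lia.
Qed.

End Zigzag.

(** * The graph made of two pieces, its linear forests and the lower bound *)

Section TwoPieces.

Variable n : nat.

(* [None] is [c], [Some (b, None)] is the vertex [w] of the piece [b]. *)
Definition piece_vertex : finType := option 'I_n.*2.
Definition two_vertex : finType := option (bool * piece_vertex).

Definition piece_adj (a a' : piece_vertex) : bool :=
  match a, a' with
  | Some x, Some y =>
      (x != y) && ((val y != antipode n x) || on_kept_diameter n x)
  | Some x, None | None, Some x => ~~ on_kept_diameter n x
  | None, None => false
  end.

Definition two_adj (u v : two_vertex) : bool :=
  match u, v with
  | Some (b, a), Some (b', a') => (b == b') && piece_adj a a'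
  | None, Some (_, a) | Some (_, a), None => a == None
  | None, None => false
  end.

Lemma piece_adj_sym : symmetric piece_adj.
Proof.
case=> [x|] [y|] //=; rewrite eq_sym; congr (_ && _).
have := ltn_ord x; have := ltn_ord y.
by rewrite /antipode /on_kept_diameter /=; do 2!case: ifP; lia.
Qed.

Lemma two_adj_sym : symmetric two_adj.
Proof.
case=> [[b a]|] [[b' a']|] //=.
by rewrite eq_sym piece_adj_sym.
Qed.

Lemma two_adj_irrefl : irreflexive two_adj.
Proof. by case=> [[b [x|]]|] //=; rewrite !eqxx. Qed.

Definition two_pieces : sgraph := SGraph two_adj_sym two_adj_irrefl.

Hypothesis n_gt1 : 1 < n.

Lemma piece_degree (a : piece_vertex) :
  #|[set a' | piece_adj a a']| = if a is None then n.*2 - 2 else n.*2.-1.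
Proof.
have cardN (B : {set piece_vertex}) : #|~: B| = n.*2.+1 - #|B|.
  by rewrite cardsCs setCK card_option card_ord.
case: a => [x|].
  (* Besides [x] itself, [y] is the only vertex of the piece not adjacent to [x]. *)
  pose y : piece_vertex := if on_kept_diameter n x then None
    else Some (Ordinal (antipode_lt (ltn_ord x))).
  have -> : [set a' | piece_adj (Some x) a'] = ~: [set Some x; y].
    apply/setP=> -[z|]; rewrite !inE /= /y; case: ifP => //= _.
      by rewrite orbT andbT orbF eq_sym.
    by rewrite orbF negb_or eq_sym.
  rewrite cardN cards2; suff -> : Some x != y by lia.
  rewrite /y; case: ifP => // _.
  by apply/eqP => -[/(congr1 val)] /= e; have := antipode_neq (ltn_ord x); lia.
have l0 : 0 < n.*2 by lia.
have ln : n < n.*2 by lia.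
have -> : [set a' | piece_adj None a'] =
    ~: (None |: [set Some (Ordinal l0); Some (Ordinal ln)]).
  by apply/setP=> -[z|]; rewrite !inE.
rewrite cardN cardsU1 cards2 !inE /=; set e := (_ != _).
have -> : e = true by apply/eqP => -[]; lia.
by lia.
Qed.

Lemma two_degree (u : two_pieces) :
  degree u = if u is None then 2 else n.*2.-1.
Proof.
rewrite /degree; case: u => [[b a]|].
  pose B := [set (Some (b, a') : two_pieces) | a' in [set a' | piece_adj a a']].
  have cardB : #|B| = #|[set a' | piece_adj a a']|.
    by rewrite card_imset // => x y [].
  have inB v : (v \in B) =
      if v is Some (b', a') then (b == b') && piece_adj a a' else false.
    apply/imsetP/idP => [[a']|].
      by rewrite inE => h -> /=; rewrite eqxx.
    by case: v => // -[b' a'] /andP[/eqP <- h]; exists a'; rewrite ?inE.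
  case: a @B cardB inB => [x|] B; rewrite piece_degree => cardB inB.
    by rewrite -cardB; apply: eq_card => -[[b' a']|]; rewrite inB inE.
  have -> : [set w | adj (Some (b, None) : two_pieces) w] = None |: B.
    by apply/setP => -[[b' a']|]; rewrite !inE inB.
  by rewrite cardsU1 inB cardB add1n; lia.
have -> : [set w | adj (None : two_pieces) w] =
    [set Some (true, None); Some (false, None)].
  by apply/setP => -[[[] [x|]]|]; rewrite !inE.
by rewrite cards2.
Qed.

Lemma two_max_degree : max_degree two_pieces = n.*2.-1.
Proof.
apply/eqP; rewrite eqn_leq; apply/andP; split.
  by apply/bigmax_leqP => u _; rewrite two_degree; case: u => [u|]; lia.
rewrite -[n.*2.-1](two_degree (Some (true, None))).
exact: (@leq_bigmax _ (@degree two_pieces)).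
Qed.

(** An edge at [w] inside a piece takes the class of the diameter that its detour replaces; the
    edges at [c] take the class [n./2], whose diameter is kept. *)
Definition two_class (u v : two_pieces) : nat :=
  match u, v with
  | Some (_, Some x), Some (_, Some y) => zigzag_class n x y
  | Some (_, Some x), _ | _, Some (_, Some x) => zigzag_class n x (antipode n x)
  | _, _ => n./2
  end.

(** The offsets 0 and 10n keep the pieces apart, with [c] between them at 6n. In class [n./2] the
    two vertices [w] flank [c]; in any other class the second half of each path moves up by one,
    freeing position n of its piece for [w]. *)
Definition two_pos (i : nat) (u : two_pieces) : nat :=
  match u with
  | None => 6 * n
  | Some (b, None) =>
      if i == n./2 then (if b then (6 * n).+1 else (6 * n).-1)
      else (if b then 10 * n else 0) + n
  | Some (b, Some x) =>
      (if b then 10 * n else 0) + zigzag_pos n i x +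
      ((i != n./2) && (n <= zigzag_pos n i x))
  end.

Lemma two_class_sym (u v : two_pieces) : two_class u v = two_class v u.
Proof.
by case: u v => [[? [x|]]|] [[? [y|]]|] //=; rewrite zigzag_class_sym.
Qed.

Lemma two_class_lt (u v : two_pieces) : two_class u v < n.
Proof.
by case: u v => [[? [x|]]|] [[? [y|]]|] //=;
  rewrite ?zigzag_class_lt ?antipode_lt ?ltn_ord //; lia.
Qed.

Lemma two_pos_inj i : i < n -> injective (two_pos i).
Proof.
move=> i_n u v; case: u v => [[b [x|]]|] [[b' [y|]]|] //=;
  try (have := zigzag_pos_lt i_n (ltn_ord x));
  try (have := zigzag_pos_lt i_n (ltn_ord y)).
- move=> ly lx e; have [eb ep] : b = b' /\ zigzag_pos n i x = zigzag_pos n i y.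
    by case: b b' e => -[]; case: (leqP n (zigzag_pos n i x));
      case: (leqP n (zigzag_pos n i y)); case: eqP => /= *; split => //; lia.
  by rewrite eb (ord_inj (zigzag_pos_inj i_n (ltn_ord x) (ltn_ord y) ep)).
- by case: b b' => -[]; case: leqP; case: eqP => /=; lia.
- by case: b; case: leqP; case: eqP => /=; lia.
- by case: b b' => -[]; case: leqP; case: eqP => /=; lia.
- by case: b b' => -[] //; case: eqP => /=; lia.
- by case: b; case: eqP => /=; lia.
- by case: b'; case: leqP; case: eqP => /=; lia.
- by case: b'; case: eqP => /=; lia.
Qed.

Lemma two_pos_adj (u v : two_pieces) : adj u v ->
  two_pos (two_class u v) v = (two_pos (two_class u v) u).+1 \/
  two_pos (two_class u v) u = (two_pos (two_class u v) v).+1.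
Proof.
have detour (x : 'I_n.*2) : ~~ on_kept_diameter n x ->
    let i := zigzag_class n x (antipode n x) in
    [/\ i != n./2 & zigzag_pos n i x = n \/ (zigzag_pos n i x).+1 = n].
  move=> h; split; first by rewrite zigzag_class_antipode.
  exact: zigzag_pos_antipode.
rewrite /adj /=; case: u v => [[b [x|]]|] [[b' [y|]]|] //=.
- case/andP=> /eqP <- /andP[xy]; set i := zigzag_class n x y.
  have := zigzag_pos_adj (ltn_ord x) (ltn_ord y) xy; rewrite /= -/i.
  case: (eqVneq (val y) (antipode n x)) => [e /= q kept|ne pc _].
    have -> : i == n./2 by rewrite /i e zigzag_class_antipode.
    by rewrite /= !addn0; lia.
  have := zigzag_pos_side (ltn_ord x) (ltn_ord y) xy ne; rewrite /= -/i => ->.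
  by lia.
- case/andP=> /eqP <- /detour /=; set i := zigzag_class _ _ _ => -[/negPf -> p].
  by case: leqP => /=; lia.
- case/andP=> /eqP <- /detour /=; set i := zigzag_class _ _ _ => -[/negPf -> p].
  by case: leqP => /=; lia.
- by rewrite andbF.
- by rewrite !eqxx; case: b; lia.
- by rewrite !eqxx; case: b'; lia.
Qed.

Lemma two_colorable s : @signature two_pieces s -> edge_colorable s n.*2.
Proof.
move=> sign_s.
apply: (linear_forests_colorable _ _ _ two_pos_adj sign_s).
- exact: two_class_sym.
- by move=> u v _; apply: two_class_lt.
- exact: two_pos_inj.
Qed.

Lemma two_not_colorable s m : m < n.*2 -> ~ @edge_colorable two_pieces s m.
Proof.
move=> lt_m [f f_col].
have m_le : m <= n.-1.*2.+1 by lia.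
have deg b a : degree (Some (b, a) : two_pieces) = n.-1.*2.+1.
  by rewrite two_degree; lia.
have zadj b a := zero_color_adj f_col m_le (deg b a).
(* Two edges colored 0 at [c] contradict uniqueness. *)
suff wc b : f (Some (b, None)) [set Some (b, None); None] = 0%R.
  have cw b : f None [set None; Some (b, None)] = 0%R.
    exact: (zero_color_sym f_col (u := Some (b, None)) _ (wc b)).
  by have := zero_color_uniq f_col (v := None) (u1 := Some (true, None))
    (u2 := Some (false, None)) isT isT (cw true) (cw false).
have [w adj_w w0] := zadj b None.
(* It remains to refute that the edge colored 0 at the vertex [w] of piece [b] stays in the piece.
   Then no vertex of the piece is matched to [c], and [g] below is a fixed-point-free involution on
   its 2n + 1 vertices. *)
case: w => [[b' a]|] // in adj_w w0 *.
have mate a0 : {a1 | piece_adj a0 a1 &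
    f (Some (b, a0)) [set Some (b, a0); Some (b, a1)] = 0%R}.
  pose P a1 := piece_adj a0 a1 &&
    (f (Some (b, a0)) [set Some (b, a0); Some (b, a1)] == 0%R).
  have : exists a1, P a1.
    have [v va v0] := zadj b a0; case: v va v0 => [[b1 a1]|].
      by case/andP => /eqP <- h h0; exists a1; rewrite /P h h0 eqxx.
    case: a0 @P => [x|] // P _ c0.
    by have := zero_color_uniq f_col (v := Some (b, None)) (u2 := None)
      adj_w isT w0 c0.
  by case/sigW => a1 /andP[h /eqP h0]; exists a1.
pose g a0 := s2val (mate a0).
have g_adj a0 : piece_adj a0 (g a0) by rewrite /g; case: (mate a0).
have g0 a0 : f (Some (b, a0)) [set Some (b, a0); Some (b, g a0)] = 0%R.
  by rewrite /g; case: (mate a0).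
have adjE a0 a1 : piece_adj a0 a1 ->
  adj (Some (b, a0) : two_pieces) (Some (b, a1)) by rewrite /= eqxx.
have [a0 _ fix0] : exists2 a0, a0 \in [set: piece_vertex] & g a0 = a0.
  apply: odd_fixpoint_of_involution => [|//|a0 _].
    by rewrite cardsT card_option card_ord /= odd_double.
  have h : piece_adj (g a0) a0 by rewrite piece_adj_sym.
  have h0 := zero_color_sym f_col (adjE _ _ (g_adj a0)) (g0 a0).
  by have [] := zero_color_uniq f_col (adjE _ _ (g_adj (g a0))) (adjE _ _ h)
    (g0 (g a0)) h0.
by have := adj_neq (adjE _ _ (g_adj a0)); rewrite fix0 eqxx.
Qed.

End TwoPieces.

Theorem theorem3 (k : nat) (hk : (1 <= k)%N) :
  exists G : sgraph, class2pm G /\ max_degree G = (2 * k + 1)%N.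
Proof.
have n_gt1 : 1 < k.+1 by [].
exists (two_pieces k.+1); split; last by rewrite two_max_degree //; lia.
move=> s sign_s; rewrite two_max_degree //; split=> //.
  exact: two_colorable.
move=> m _ col_m; rewrite leqNgt; apply/negP => lt_m.
exact: two_not_colorable col_m.
Qed.
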